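(* In the comparison query model, there is a $2$-competitive algorithm for verifying that a given matching $M$ in a stable matching instance with uncertain preferences on both sides is stable.
   Context: Two disjoint sets $A$, $B$ of agents with $|A|=|B|=n$. Each $a\in A$ has a strict total order $\prec_a$ on $B$ and each $b\in B$ has a strict total order $\prec_b$ on $A$ ($x\prec_y z$: $y$ prefers $x$ to $z$). A matching is a bijection between $A$ and $B$; it is stable if there is no pair $(a,b)$, $b\neq M(a)$, with $a$ preferring $b$ to $M(a)$ and $b$ preferring $a$ to $M(b)$. Two-sided uncertainty: all preference orders of agents in $A$ and in $B$ are initially unknown and are learned only via comparison queries: for an agent $x$ and two agents $y_1,y_2$ of the other side, $\mathit{prefer}(x,y_1,y_2)$ returns whichever of $y_1,y_2$ agent $x$ prefers. An algorithm queries adaptively until the answers prove its output correct (for every preference profile consistent with the answers). It is $\rho$-competitive if its number of queries is at most $\rho$ times the minimum size of a query set whose answers suffice to prove that $M$ is stable; the competitive ratio is measured only on inputs where $M$ is stable, and otherwise the algorithm must detect that $M$ is not stable. *)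

(* Defs.v *)
From HB Require Import structures.
From mathcomp Require Import all_boot all_order all_algebra.

Set Implicit Arguments.
Unset Strict Implicit.
Unset Printing Implicit Defensive.

Import Order.TTheory GRing.Theory Num.Theory.

(* The two disjoint sides of the market are two finite types
   A and B; the set of all agents is the disjoint sum A + B. *)

Definition strict_total_order (T : eqType) (r : rel T) : Prop :=
  [/\ irreflexive r, transitive r & forall x y, x != y -> r x y || r y x].

(* prefA P a b b' : agent a prefers b to b'; similarly for prefB. *)
Record profile (A B : finType) := Profile {
  prefA : A -> rel B;
  prefB : B -> rel A;
  prefA_order : forall a, strict_total_order (prefA a);
  prefB_order : forall b, strict_total_order (prefB b)
}.

(* A bijection between A and B, given with its inverse: M(a) is mateA M a and
   M(b) is mateB M b. *)
Record matching (A B : finType) := Matching {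
  mateA : A -> B;
  mateB : B -> A;
  mateAK : cancel mateA mateB;
  mateBK : cancel mateB mateA
}.

Definition blocking_pair (A B : finType) (P : profile A B) (M : matching A B)
    (a : A) (b : B) : bool :=
  [&& b != mateA M a, prefA P a b (mateA M a) & prefB P b a (mateB M b)].

Definition stable (A B : finType) (P : profile A B) (M : matching A B) : Prop :=
  ~ exists a b, blocking_pair P M a b.

(* inl (a, b1, b2) is the query prefer(a, b1, b2) and inr (b, a1, a2) is the
   query prefer(b, a1, a2). The degenerate queries with b1 = b2 (or a1 = a2)
   are allowed: they cost one query and reveal nothing. Likewise the two
   orderings of the compared agents are distinct queries with the same answer,
   so a query set of minimum size contains neither redundancy. *)
Definition query (A B : finType) : finType := ((A * B * B) + (B * A * A))%type.

Definition prefer (A B : finType) (P : profile A B) (q : query A B) : A + B :=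
  match q with
  | inl (a, b1, b2) => inr (if prefA P a b1 b2 then b1 else b2)
  | inr (b, a1, a2) => inl (if prefB P b a1 a2 then a1 else a2)
  end.

(* Deterministic adaptive algorithms on a fixed input (A, B, M): the next step
   depends on the answers received so far. Output true means "M is stable",
   Output false means "M is not stable". *)
Inductive strategy (A B : finType) : Type :=
  | Output of bool
  | Ask of query A B & (A + B -> strategy A B).

Fixpoint verdict (A B : finType) (s : strategy A B) (P : profile A B) : bool :=
  match s with
  | Output o => o
  | Ask q next => verdict (next (prefer P q)) P
  end.

(* The queries made on P, in order and with repetitions. *)
Fixpoint asked (A B : finType) (s : strategy A B) (P : profile A B) :
    seq (query A B) :=
  match s with
  | Output _ => [::]
  | Ask q next => q :: asked (next (prefer P q)) P
  end.

(* On every profile P the answers received prove the verdict, i.e. it is right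
   for every profile P' consistent with them. *)
Definition verifies (A B : finType) (s : strategy A B) (M : matching A B) :
    Prop :=
  forall P P' : profile A B,
    {in asked s P, prefer P' =1 prefer P} ->
    (verdict s P <-> stable P' M).

Definition proves_stable (A B : finType) (P : profile A B) (M : matching A B)
    (Q : {set query A B}) : Prop :=
  forall P' : profile A B, {in Q, prefer P' =1 prefer P} -> stable P' M.

Definition is_min_proof_size (A B : finType) (P : profile A B)
    (M : matching A B) (k : nat) : Prop :=
  (exists2 Q : {set query A B}, proves_stable P M Q & #|Q| = k) /\
  (forall Q : {set query A B}, proves_stable P M Q -> k <= #|Q|).

(* The number k is unique; it exists because M is stable for P. *)
Definition competitive (A B : finType) (rho : rat) (s : strategy A B)
    (M : matching A B) : Prop :=
  forall P : profile A B, stable P M ->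
    exists2 k : nat, is_min_proof_size P M k &
      ((size (asked s P))%:R <= rho * k%:R)%R.

(* Main.v *)
Require Import Defs.
From mathcomp Require Import all_boot all_order all_algebra.

(** Call a pair (a, b) with b <> M(a) unmatched.  A query compares two agents,
    and its loser, together with the agent asked, forms a pair.  If an unmatched
    pair (a, b) is the losing pair of no query in Q, then moving b to the top of
    a's order and a to the top of b's order changes no answer in Q, yet makes
    (a, b) blocking.  Hence every proof of stability has at least as many queries
    as there are unmatched pairs; when M is stable one query per unmatched pair
    is enough, and the algorithm that asks a and, if necessary, b about every
    unmatched pair uses at most two. *)

Set Implicit Arguments.
Unset Strict Implicit.
Unset Printing Implicit Defensive.

Section StrictTotalOrder.
Variables (T : eqType) (r : rel T).
Hypothesis r_order : strict_total_order r.

Lemma strict_total_orderN x y : x != y -> r x y = ~~ r y x.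
Proof.
case: r_order => irr tr tot xy; have := tot x y xy.
case rxy: (r x y); case ryx: (r y x) => //= _.
by have := tr _ _ _ rxy ryx; rewrite irr.
Qed.

(** [r] with [z] moved to the top; the guard [y != z] also keeps [raise z z z] false. *)
Definition raise (z : T) : rel T := fun x y => (y != z) && ((x == z) || r x y).

Lemma raise_order z : strict_total_order (raise z).
Proof.
case: r_order => irr tr tot; split.
- by move=> x; rewrite /raise irr orbF andNb.
- move=> y x w /andP[yz /orP[/eqP-> | rxy]] /andP[wz].
    by move=> _; rewrite /raise wz eqxx.
  by rewrite (negPf yz) /raise wz /= => /(tr _ _ _ rxy)->; rewrite orbT.
- move=> x y; rewrite /raise.
  have [->|_] := eqVneq x z; first by rewrite eq_sym => ->.
  by have [//|_] := eqVneq y z => /tot.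
Qed.

(** If the loser is not [z], then [z] either is not compared or has already won, so raising it
    cannot alter the answer. *)
Lemma raise_winner z x y : (if r x y then y else x) != z ->
  (if raise z x y then x else y) = (if r x y then x else y).
Proof.
rewrite /raise; have [->|yz] := eqVneq y z; first by case: (r x z); rewrite ?eqxx.
by have [->|xz] := eqVneq x z; case: (r _ y); rewrite ?eqxx.
Qed.

End StrictTotalOrder.

(** A strategy sees a profile only through its answers, so both runs follow the same branch. This
    reduces [verifies] to correctness of the verdict on [P'] itself. *)
Lemma verdict_asked (A B : finType) (s : strategy A B) (P P' : profile A B) :
  {in asked s P, prefer P' =1 prefer P} -> verdict s P' = verdict s P.
Proof.
elim: s => //= q next IH eqPP'.
rewrite eqPP' ?mem_head //; apply: IH => p p_asked.
by apply: eqPP'; rewrite inE p_asked orbT.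
Qed.

Section Verification.
Variables (A B : finType) (M : matching A B).
Implicit Types (P : profile A B) (Q : {set query A B}).

Definition unmatched : {set A * B} := [set p | p.2 != mateA M p.1].

Lemma mateB_neq a b : b != mateA M a -> a != mateB M b.
Proof. by apply: contra => /eqP->; rewrite mateBK. Qed.

Definition askA (a : A) (b : B) : query A B := inl (a, mateA M a, b).
Definition askB (a : A) (b : B) : query A B := inr (b, mateB M b, a).

Lemma prefer_askA P a b : b != mateA M a ->
  (prefer P (askA a b) == inr (mateA M a)) = ~~ prefA P a b (mateA M a).
Proof.
move=> ab; rewrite (strict_total_orderN (prefA_order P a) ab) negbK /=.
by case: ifP; rewrite ?eqxx // => _; apply/negP => /eqP[]; apply/eqP.
Qed.

Lemma prefer_askB P a b : b != mateA M a ->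
  (prefer P (askB a b) == inl (mateB M b)) = ~~ prefB P b a (mateB M b).
Proof.
move=> /mateB_neq ab; rewrite (strict_total_orderN (prefB_order P b) ab) negbK /=.
by case: ifP; rewrite ?eqxx // => _; apply/negP => /eqP[]; apply/eqP.
Qed.

Definition raise_pair P a b : profile A B :=
  @Profile A B
    (fun x => if x == a then raise (prefA P x) b else prefA P x)
    (fun y => if y == b then raise (prefB P y) a else prefB P y)
    (fun x => match x == a as e return
                strict_total_order (if e then raise (prefA P x) b else prefA P x)
              with
              | true => raise_order (prefA_order P x) b
              | false => prefA_order P x
              end)
    (fun y => match y == b as e return
                strict_total_order (if e then raise (prefB P y) a else prefB P y)
              with
              | true => raise_order (prefB_order P y) a
              | false => prefB_order P y
              end).

Lemma raise_pair_blocking P a b :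
  b != mateA M a -> blocking_pair (raise_pair P a b) M a b.
Proof.
move=> ab; have ba := mateB_neq ab.
by rewrite /blocking_pair ab /= /raise !eqxx (eq_sym (mateA M a))
  (eq_sym (mateB M b)) ab ba.
Qed.

(** Every query, even a degenerate one, is charged to exactly one pair, so [Q] covers at most [#|Q|]
    pairs. *)
Definition losing_pair P (q : query A B) : A * B :=
  match q with
  | inl (a, b1, b2) => (a, if prefA P a b1 b2 then b2 else b1)
  | inr (b, a1, a2) => (if prefB P b a1 a2 then a2 else a1, b)
  end.

Lemma prefer_raise_pair P a b q :
  losing_pair P q != (a, b) -> prefer (raise_pair P a b) q = prefer P q.
Proof.
case: q => [[[x b1] b2] | [[y a1] a2]] /=; rewrite xpair_eqE.
  by have [-> /= lose|//] := eqVneq x a; rewrite raise_winner.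
by rewrite andbC; have [-> /= lose|//] := eqVneq y b; rewrite raise_winner.
Qed.

Lemma proof_size_lower_bound P Q : proves_stable P M Q -> #|unmatched| <= #|Q|.
Proof.
(* It suffices that the losing pairs of [Q] cover [unmatched]. *)
move=> Qstable; apply: leq_trans (leq_imset_card (losing_pair P) (mem Q)).
apply/subset_leq_card/subsetP => -[a b]; rewrite inE /= => ab.
apply/negPn/negP => abQ; apply: (Qstable (raise_pair P a b)).
  move=> q Qq; apply: prefer_raise_pair; apply: contraNneq abQ => <-.
  exact: imset_f.
by exists a, b; apply: raise_pair_blocking.
Qed.

Lemma min_proof_size P : stable P M -> is_min_proof_size P M #|unmatched|.
Proof.
move=> Pstable; split; last exact: proof_size_lower_bound.
(* By stability one agent of each unmatched pair prefers its mate: [b] if [a] prefers [b], and [a]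
   otherwise. That agent is asked. *)
pose witness (p : A * B) :=
  if prefA P p.1 p.2 (mateA M p.1) then askB p.1 p.2 else askA p.1 p.2.
have Qstable : proves_stable P M (witness @: unmatched).
  move=> P' eqPP' [a [b /and3P[ab a_blocks b_blocks]]].
  have : witness (a, b) \in witness @: unmatched by rewrite imset_f ?inE.
  move=> /eqPP'; rewrite /witness /=; case: ifPn => [aP | naP] eq_ans.
    (* [P] and [P'] agree on this answer, so [b] prefers [a] in [P] too, and the pair would block
       [P]. *)
    have := prefer_askB P' ab; rewrite b_blocks eq_ans prefer_askB //.
    by move/negbFE => bP; apply: Pstable; exists a, b; apply/and3P.
  by have := prefer_askA P' ab; rewrite a_blocks eq_ans prefer_askA // naP.
exists (witness @: unmatched) => //; apply/eqP.
(* An image has at most [#|unmatched|] elements; the lower bound, applied to this proof of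
   stability, gives the converse. *)
by rewrite eqn_leq leq_imset_card (proof_size_lower_bound Qstable).
Qed.

(** [b] is asked only when [a] prefers [b] to its mate, and the run stops at the first blocking
    pair. *)
Fixpoint check_pairs (s : seq (A * B)) : strategy A B :=
  if s is (a, b) :: s' then
    Ask (askA a b) (fun ansA =>
      if ansA == inr (mateA M a) then check_pairs s'
      else Ask (askB a b) (fun ansB =>
        if ansB == inl (mateB M b) then check_pairs s' else Output A B false))
  else Output A B true.

Lemma size_check_pairs P s : size (asked (check_pairs s) P) <= 2 * size s.
Proof.
elim: s => //= -[a b] s IH; rewrite [asked _ _]/= [size _]/= mulnS.
case: ifP => _ /=; first by rewrite add2n ltnS leqW.
by case: ifP => _ /=; rewrite add2n !ltnS.
Qed.

Lemma verdict_check_pairs P s : {subset s <= unmatched} ->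
  verdict (check_pairs s) P = all (fun p => ~~ blocking_pair P M p.1 p.2) s.
Proof.
elim: s => //= -[a b] s IH sub.
have ab : b != mateA M a by have := sub _ (mem_head _ _); rewrite inE.
have {}IH := IH (fun p sp => sub p (mem_behead (s := (a, b) :: s) sp)).
(* One step of the run is unfolded by conversion, exposing the test that [prefer_askA] evaluates. *)
rewrite -[verdict _ _]/(verdict (if prefer P (askA a b) == _ then _ else _) P).
rewrite prefer_askA // /blocking_pair /= ab /=.
case: (prefA P a b _) => //=.
rewrite -[verdict _ _]/(verdict (if prefer P (askB a b) == _ then _ else _) P).
by rewrite prefer_askB //; case: (prefB P b a _).
Qed.

(** A blocking pair is unmatched by definition, so scanning [unmatched] misses none. *)
Lemma verdict_stable P : verdict (check_pairs (enum unmatched)) P <-> stable P M.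
Proof.
rewrite verdict_check_pairs => [|p]; last by rewrite mem_enum.
split=> [/allP no_block [a [b ab]] | Pstable].
  have /(no_block (a, b)) : (a, b) \in enum unmatched.
    by rewrite mem_enum inE; case/and3P: ab.
  by rewrite ab.
by apply/allP => -[a b] _; apply/negP => ab; apply: Pstable; exists a, b.
Qed.

End Verification.

Theorem theorem13 :
  exists alg : forall A B : finType, matching A B -> strategy A B,
    forall (n : nat) (A B : finType) (M : matching A B),
      #|A| = n -> #|B| = n ->
      verifies (alg A B M) M /\ competitive 2%R (alg A B M) M.
Proof.
exists (fun A B M => check_pairs M (enum (unmatched M))) => n A B M _ _; split.
  by move=> P P' /verdict_asked<-; apply: verdict_stable.
move=> P /min_proof_size min_size; exists #|unmatched M| => //.
by rewrite -GRing.natrM Num.Theory.ler_nat cardE size_check_pairs.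
Qed.
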